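(* Let $\mathcal{X}$ be a real Banach space with $\dim(\mathcal{X})\ge 2$ and let $\kappa,\tau>0$. Then $$\sqrt{\kappa^2+\tau^2}\le \mathcal{T}_1(\kappa,\tau,\mathcal{X})\le \kappa+\tau.$$
   Context: $S_{\mathcal{X}}$ denotes the unit sphere of $\mathcal{X}$. For $\kappa,\tau>0$, $$\mathcal{T}_1(\kappa,\tau,\mathcal{X})=\sup_{x_1,x_2\in S_{\mathcal{X}}}\big(\|\kappa x_1+\tau x_2\|\,\|\kappa x_1-\tau x_2\|\big)^{1/2}.$$ *)

(* Defs.v *)
From HB Require Import structures.
From mathcomp Require Import all_boot all_order all_algebra.
From mathcomp Require Import all_classical all_reals all_analysis.
Import Order.TTheory GRing.Theory Num.Theory.
Import numFieldNormedType.Exports.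

Set Implicit Arguments.
Unset Strict Implicit.
Unset Printing Implicit Defensive.

Local Open Scope classical_set_scope.
Local Open Scope ring_scope.

(* [dim V >= n] for a possibly infinite-dimensional space, for which the library
   has no dimension function: there are n linearly independent vectors. *)
Definition dim_geq (R : realType) (n : nat) (V : lmodType R) : Prop :=
  exists v : 'I_n -> V, forall a : 'I_n -> R,
    \sum_(i < n) a i *: v i = 0 -> forall i, a i = 0.

Definition unit_sphere (R : realType) (X : normedModType R) : set X :=
  [set x | `|x| = 1].

(* [sup] is real-valued, with value 0 on a set that is empty or unbounded above.
   By the triangle inequality the set below is bounded above by kappa + tau (for
   kappa, tau >= 0), and it is nonempty as soon as X is nonzero. *)
Definition T1 (R : realType) (kappa tau : R) (X : normedModType R) : R :=
  sup [set Num.sqrt (`|kappa *: x.1 + tau *: x.2| * `|kappa *: x.1 - tau *: x.2|)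
      | x in @unit_sphere R X `*` @unit_sphere R X].

(* Main.v *)
Require Import Defs.
From HB Require Import structures.
From mathcomp Require Import all_boot all_order all_algebra.
From mathcomp Require Import all_classical all_reals all_analysis.
From mathcomp Require Import ring lra.
Import Order.TTheory GRing.Theory Num.Theory.
Import numFieldNormedType.Exports.

Set Implicit Arguments.
Unset Strict Implicit.
Unset Printing Implicit Defensive.

(** The upper bound is the triangle inequality.  For the lower bound put
    c0 = sqrt (kappa^2 + tau^2).  It suffices to find, for every c < c0 close
    to c0, unit vectors x and y such that both kappa x + tau y and
    kappa x - tau y have norm at least c ([pair_far_from_origin]).

    Such a pair comes from a theorem of Nordlander: if 0 < eps < 2, M > 0 and
    eps^2 + M^2 > 4, some unit vectors u, v satisfy |v - u| = eps and
    |v + u| <= M ([nordlander]).  With eps = 2 tau / c and M = 2 kappa / c, the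
    vectors a = (c/2) (v + u) and b = (c/2) (v - u) satisfy |a| <= kappa and
    |b| = tau, while a + b = c v and a - b = c u have norm c.  Stretching a to norm kappa cannot bring a + b or a - b back
    inside the ball of radius c, by convexity of the norm
    ([ge_norm_scale_add]).

    Nordlander's theorem is a statement about a norm on the plane.  Let p(s) be
    the point of the unit circle in direction s, and let H be a primitive of
    1 / |(cos, sin)|^2, so that H t - H s is twice the area of the sector of
    the unit ball between the directions s and t.  When u = p(s) and v = p(t)
    move along the circle, the vectors r = v - u and q = v + u satisfy
      det(r, dr) + det(q, dq) = 2 (det(u, du) + det(v, dv)),
    that is, |r|^2 dH(psi) + |q|^2 dH(phi) = 2 (dH(s) + dH(t)), where psi and
    phi are the directions of r and q.  Classically one integrates this along
    the closed curve |r| = eps, so that the mean of |q|^2 is 4 - eps^2.  The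
    integration is replaced here by an extremum argument.  Suppose |q| > M
    wherever |r| = eps, and put k = (eps^2 + M^2) / 2 > 2.  The function
      G(s, t) = eps^2 H(psi) + M^2 H(phi) - k (H(s) + H(t))
    is invariant under a simultaneous half turn of s and t, so it attains its
    minimum on the level set |r| = eps ([chord_level_min]).  But from any point
    of the level set one can advance along it, with s and t both nondecreasing
    ([chord_level_advance]); both determinants on the left are then nonnegative
    ([advance]), and to first order G changes by at most
    (2 - k) (dH(s) + dH(t)) < 0: a contradiction. *)

Local Open Scope classical_set_scope.
Local Open Scope ring_scope.

(** * Primitives and sectors *)

(** Integrating from 0 gives a primitive to the right of 0 only, which is
    enough: all the directions used below are positive. *)
Lemma exists_antiderivative (R : realType) (f : R -> R) :
  continuous f ->
  exists H : R -> R, forall x : R, 0 < x -> is_derive x (1 : R) H (f x).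
Proof.
move=> cf.
exists (fun x => \int[lebesgue_measure]_(t in [set` `[0, x]]) f t)%R => x x0.
have xu : x < x + 1 by rewrite ltrDl.
have fint : (@lebesgue_measure R).-integrable `[0, x + 1] (EFin \o f).
  apply: continuous_compact_integrable; first exact: segment_compact.
  exact: continuous_subspaceT.
have [dF F'] := continuous_FTC1_closed xu fint x0 (cf x).
by apply: DeriveDef; [exact: dF | rewrite -derive1E; exact: F'].
Qed.

(** The difference H (x + T) - H x has derivative zero. *)
Lemma antiderivative_periodic (R : realType) (f H : R -> R) (T : R) : 0 < T ->
  periodic f T ->
  (forall x : R, 0 < x -> is_derive x (1 : R) H (f x)) ->
  exists A : R, forall x, 0 < x -> H (x + T) = H x + A.
Proof.
move=> T0 fT dH; exists (H (1 + T) - H 1) => x x0.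
pose G (y : R) := H (expR y + T) - H (expR y).
(* Precomposing with exp turns the half-line of positive reals into R. *)
have dG y : is_derive y (1 : R) G 0.
  have e0 := expR_gt0 y.
  have d1 := dH _ e0.
  have d2 : is_derive (expR y + T) (1 : R) H (f (expR y + T)).
    by apply: dH; rewrite addr_gt0.
  have d3 : is_derive y (1 : R) (fun z => expR z + T) (expR y).
    by apply: is_derive_eq; rewrite addr0.
  have c1 := is_derive1_comp d1 (is_derive_expR y).
  have c2 := @is_derive1_comp _ H (fun z => expR z + T) y _ _ d2 d3.
  apply: (@is_derive_eq _ _ _ _ _ _ _ _ (is_deriveB c2 c1)).
  by rewrite fT subrr.
have := is_derive_0_is_cst (ln x) 0 dG.
rewrite /G lnK ?posrE// expR0 => <-; by rewrite addrCA subrr addr0.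
Qed.

(** For a = 1 / |(cos, sin)| the two quantities compared are twice the areas of
    the sector of the unit ball between the directions x and y, and of the
    triangle inscribed in it.  Both are a(x)^2 (y - x) to first order. *)
Lemma sector_ratio (R : realType) (a H : R -> R) (x eta : R) :
  0 < a x -> {for x, continuous a} -> is_derive x (1 : R) H (a x ^+ 2) ->
  0 < eta ->
  \forall y \near x, x <= y ->
    (1 - eta) * (a x * a y * sin (y - x)) <= H y - H x /\
    H y - H x <= (1 + eta) * (a x * a y * sin (y - x)).
Proof.
move=> ax ca dH eta0.
pose S (h : R) := a x * a (h + x) * sin h.
have limH : h^-1 *: (H (h + x) - H x) @[h --> (0:R)^'] --> a x ^+ 2.
  have [ex ev] := dH.
  have E : (fun h : R => h^-1 *: (H (h + x) - H x)) =
      (fun h : R => h^-1 *: ((H \o shift x) (h *: (1 : R)) - H x)).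
    by apply/funext => h; rewrite /= [h *: _]mulr1.
  by rewrite -ev E; exact: ex.
have lims : h^-1 *: sin h @[h --> (0:R)^'] --> (1 : R).
  have [ex ev] := is_derive_sin (0:R).
  have E : (fun h : R => h^-1 *: sin h) =
      (fun h : R => h^-1 *: ((sin \o shift 0) (h *: (1 : R)) - sin 0)).
    by apply/funext => h; rewrite /= [h *: _]mulr1 addr0 sin0 subr0.
  by rewrite -[X in _ --> X](@cos0 R) -ev E; exact: ex.
have lima : a (h + x) @[h --> (0:R)^'] --> a x.
  have sx : (h + x) @[h --> (0:R)^'] --> x.
    rewrite -[X in _ --> X]add0r; apply: cvgD; last exact: cvg_cst.
    exact: cvg_within.
  exact: cvg_comp sx ca.
have limS : h^-1 *: S h @[h --> (0:R)^'] --> a x ^+ 2.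
  have -> : a x ^+ 2 = a x * a x * 1 by rewrite mulr1 expr2.
  have -> : (fun h => h^-1 *: S h) = (fun h => (a x * a (h + x)) * (h^-1 *: sin h)).
    by apply/funext => h; rewrite /S /GRing.scale /= mulrCA.
  apply: cvgM => //; apply: cvgM => //; exact: cvg_cst.
have ax2 : 0 < eta * a x ^+ 2 by rewrite mulr_gt0// exprn_gt0.
have up : \forall h \near (0:R)^', 0 < (1 + eta) * (h^-1 *: S h) - h^-1 *: (H (h + x) - H x).
  apply: (cvgr_gt (eta * a x ^+ 2)) => //.
  have -> : eta * a x ^+ 2 = (1 + eta) * a x ^+ 2 - a x ^+ 2 by ring.
  by apply: cvgB => //; apply: cvgM => //; exact: cvg_cst.
have lo : \forall h \near (0:R)^', 0 < h^-1 *: (H (h + x) - H x) - (1 - eta) * (h^-1 *: S h).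
  apply: (cvgr_gt (eta * a x ^+ 2)) => //.
  have -> : eta * a x ^+ 2 = a x ^+ 2 - (1 - eta) * a x ^+ 2 by ring.
  by apply: cvgB => //; apply: cvgM => //; exact: cvg_cst.
have /nbhs_ballP [e e0 he] : \forall h \near (0:R), h != 0 ->
  0 < (1 + eta) * (h^-1 *: S h) - h^-1 *: (H (h + x) - H x) /\
  0 < h^-1 *: (H (h + x) - H x) - (1 - eta) * (h^-1 *: S h).
  exact: (filterI up lo).
apply/nbhs_ballP; exists e => // y xy xley.
have [->|yx] := eqVneq y x; first by rewrite !subrr sin0 !mulr0.
have h0 : 0 < y - x by rewrite subr_gt0 lt_neqAle eq_sym yx.
have := he (y - x); rewrite /ball/= sub0r normrN distrC => /(_ xy (lt0r_neq0 h0)).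
rewrite /S subrK /GRing.scale /= => -[h1 h2].
have := mulr_gt0 h0 h1; have := mulr_gt0 h0 h2.
have yi : (y - x) * (y - x)^-1 = 1 by rewrite divff// lt0r_neq0.
set A := a x * a y * sin (y - x).
rewrite !mulrBr ![(y - x) * ((y-x)^-1 * _)]mulrA ![(y - x) * ((_ + _) * _)]mulrCA.
rewrite ![(y - x) * ((y-x)^-1 * _)]mulrA yi !mul1r => g1 g2.
split; lra.
Qed.

(** * The unit circle of a norm on the plane *)

Section PlaneNorm.
Variables (R : realType) (nu : R -> R -> R).
Hypothesis nuD : forall x y x' y', nu (x + x') (y + y') <= nu x y + nu x' y'.
Hypothesis nuZ : forall k x y, nu (k * x) (k * y) = `|k| * nu x y.
Hypothesis nu_eq0 : forall x y, nu x y = 0 -> x = 0 /\ y = 0.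

Lemma nu_ge0 x y : 0 <= nu x y.
Proof.
have := nuD x y ((-1) * x) ((-1) * y).
rewrite nuZ normrN1 !mul1r !mulN1r !subrr.
have -> : nu 0 0 = 0 by have := nuZ 0 0 0; rewrite !mul0r normr0 mul0r.
lra.
Qed.

Lemma nu_gt0 x y : x != 0 \/ y != 0 -> 0 < nu x y.
Proof.
move=> xy; rewrite lt_neqAle nu_ge0 andbT eq_sym.
apply/negP => /eqP /nu_eq0[x0 y0].
by case: xy; rewrite ?x0 ?y0 eqxx.
Qed.

Lemma nu_cvg {T : Type} {F : set_system T} {FF : Filter F} (f g : T -> R) (x y : R) :
  f @ F --> x -> g @ F --> y -> (fun t => nu (f t) (g t)) @ F --> nu x y.
Proof.
move=> fx gy.
pose e t := `|f t - x| * nu 1 0 + `|g t - y| * nu 0 1.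
have nule a b a' b' : nu a b - nu a' b' <= `|a - a'| * nu 1 0 + `|b - b'| * nu 0 1.
  rewrite -!nuZ !mulr0 !mulr1.
  have := nuD (a - a') 0 0 (b - b'); rewrite addr0 add0r.
  have := nuD a' b' (a - a') (b - b'); rewrite !subrKC.
  lra.
have e0 : e @ F --> 0.
  rewrite -[X in _ --> X](addr0 0) -[X in _ --> X + _](mul0r (nu 1 0)).
  rewrite -[X in _ --> _ + X](mul0r (nu 0 1)).
  apply: cvgD; apply: cvgMl; rewrite -(normr0 R).
    by apply: cvg_norm; rewrite -(subrr x); apply: cvgB => //; exact: cvg_cst.
  by apply: cvg_norm; rewrite -(subrr y); apply: cvgB => //; exact: cvg_cst.
apply/cvgrPdist_le => d d0.
have := @cvgr0_norm_le _ _ _ F FF e e0 d d0.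
apply: filterS => t; apply: le_trans.
rewrite [leRHS]ger0_norm; last by rewrite addr_ge0// mulr_ge0// nu_ge0.
rewrite ler_norml; apply/andP; split; last first.
  by rewrite /e (distrC (f t)) (distrC (g t)); exact: nule.
by rewrite lerNl opprB; exact: nule.
Qed.

(** [(px s, py s)] is the point of the unit circle of [nu] in direction [s]. *)
Definition radius (s : R) : R := (nu (cos s) (sin s))^-1.
Definition px s := radius s * cos s.
Definition py s := radius s * sin s.
Definition area2 s t := px s * py t - py s * px t.

Lemma nu_cossin_gt0 s : 0 < nu (cos s) (sin s).
Proof.
apply: nu_gt0; have := cos2Dsin2 s.
have [->|] := eqVneq (cos s) 0; last by left.
have [->|] := eqVneq (sin s) 0; last by right.
by rewrite expr0n addr0 => /esym /eqP; rewrite oner_eq0.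
Qed.

Lemma radius_gt0 s : 0 < radius s.
Proof. by rewrite invr_gt0 nu_cossin_gt0. Qed.

Lemma nu_pt s : nu (px s) (py s) = 1.
Proof.
rewrite nuZ (gtr0_norm (radius_gt0 s)) mulVf//.
by rewrite lt0r_neq0// nu_cossin_gt0.
Qed.

Lemma nu_Zpt k s : nu (k * px s) (k * py s) = `|k|.
Proof. by rewrite nuZ nu_pt mulr1. Qed.

Lemma nuN x y : nu (- x) (- y) = nu x y.
Proof. by rewrite -(mulN1r x) -(mulN1r y) nuZ normrN1 mul1r. Qed.

Lemma radiusDpi s : radius (s + pi) = radius s.
Proof. by rewrite /radius cosDpi sinDpi nuN. Qed.

Lemma pxDpi s : px (s + pi) = - px s.
Proof. by rewrite /px radiusDpi cosDpi mulrN. Qed.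
Lemma pyDpi s : py (s + pi) = - py s.
Proof. by rewrite /py radiusDpi sinDpi mulrN. Qed.

Lemma continuous_radius : continuous radius.
Proof.
move=> s; apply: cvgV; first by rewrite lt0r_neq0// nu_cossin_gt0.
apply: nu_cvg; [exact: continuous_cos|exact: continuous_sin].
Qed.
Lemma continuous_px : continuous px.
Proof. move=> s; apply: cvgM; [exact: continuous_radius|exact: continuous_cos]. Qed.
Lemma continuous_py : continuous py.
Proof. move=> s; apply: cvgM; [exact: continuous_radius|exact: continuous_sin]. Qed.

Lemma area2E s t : area2 s t = radius s * radius t * sin (t - s).
Proof. rewrite /area2 /px /py sinB; ring. Qed.

Lemma area2_ge0 s t : s <= t -> t - s < pi -> 0 <= area2 s t.
Proof.
move=> st stpi; rewrite area2E !mulr_ge0 ?(ltW (radius_gt0 _))//.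
have [->|st'] := eqVneq s t; first by rewrite subrr sin0.
by apply/ltW/sin_gt0_pi; rewrite stpi andbT subr_gt0 lt_neqAle st' st.
Qed.

Lemma area2_gt0 s t : s < t -> t - s < pi -> 0 < area2 s t.
Proof.
move=> st stpi; rewrite area2E !mulr_gt0 ?radius_gt0//.
by apply: sin_gt0_pi; rewrite stpi subr_gt0 st.
Qed.

Lemma area2C s t : area2 s t = - area2 t s.
Proof. rewrite /area2; ring. Qed.

Lemma le_of_area2_ge0 s t : `|s - t| < pi -> 0 <= area2 s t -> s <= t.
Proof.
move=> st a0; rewrite leNgt; apply/negP => ts.
have : 0 < area2 t s by apply: area2_gt0 => //; apply: le_lt_trans st; exact: ler_norm.
by rewrite area2C oppr_gt0 ltNge a0.
Qed.

(** Cramer's rule in the basis formed by the points of directions [s] and [t]: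
    a point of the arc between them lies in the cone that they span. *)
Lemma arc_decomp s w t : s <= w -> w <= t -> 0 < t - s -> t - s < pi ->
  exists a b, [/\ 0 <= a, 0 <= b, px w = a * px s + b * px t,
    py w = a * py s + b * py t &
    area2 s w = b * area2 s t /\ area2 w t = a * area2 s t].
Proof.
move=> sw wt st0 stpi.
have D0 : 0 < area2 s t by apply: area2_gt0 => //; rewrite -subr_gt0.
have Dn := lt0r_neq0 D0.
exists (area2 w t / area2 s t), (area2 s w / area2 s t); split.
- by apply: divr_ge0; [apply: area2_ge0 => //; lra|exact: ltW].
- by apply: divr_ge0; [apply: area2_ge0 => //; lra|exact: ltW].
- by move: Dn; rewrite /area2 => Dn; field.
- by move: Dn; rewrite /area2 => Dn; field.
- by rewrite !divfK.
Qed.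

(** Divided by [area2 s t], these are the triangle inequalities for the
    expression w = a p(s) + b p(t) between unit vectors, since the areas are
    proportional to the coefficients 1, a and b. *)
Lemma arc_triangle s w t : s <= w -> w <= t -> 0 < t - s -> t - s < pi ->
  [/\ area2 s t <= area2 s w + area2 w t,
      area2 w t <= area2 s t + area2 s w &
      area2 s w <= area2 s t + area2 w t].
Proof.
move=> sw wt st0 stpi.
have D0 : 0 < area2 s t by apply: area2_gt0 => //; rewrite -subr_gt0.
have [a [b [a0 b0 xE yE [-> ->]]]] := arc_decomp sw wt st0 stpi.
have aD : nu (a * px s) (a * py s) = a by rewrite nu_Zpt ger0_norm.
have bD : nu (b * px t) (b * py t) = b by rewrite nu_Zpt ger0_norm.
have h1 : 1 <= a + b.
  by rewrite -(nu_pt w) -[X in _ <= X + _]aD -bD xE yE nuD.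
have h2 : a <= 1 + b.
  rewrite -[leLHS]aD -(nu_pt w) -[X in _ <= _ + X]bD -[X in _ <= _ + X]nuN.
  by apply: le_trans (nuD _ _ _ _); rewrite xE yE !addrK.
have h3 : b <= 1 + a.
  rewrite -[leLHS]bD -(nu_pt w) -[X in _ <= _ + X]aD -[X in _ <= _ + X]nuN.
  by apply: le_trans (nuD _ _ _ _); rewrite xE yE !(addrC (a * _)) !addrK.
split.
- by rewrite -mulrDl (addrC b); apply: ler_peMl => //; exact: ltW.
- by rewrite -[X in _ <= X + _]mul1r -mulrDl ler_wpM2r //; exact: ltW.
- by rewrite -[X in _ <= X + _]mul1r -mulrDl ler_wpM2r //; exact: ltW.
Qed.

Definition chord s t := nu (px t - px s) (py t - py s).
Definition sum_norm s t := nu (px t + px s) (py t + py s).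

Lemma chordC s t : chord s t = chord t s.
Proof. by rewrite /chord -nuN !opprB. Qed.

(** Monotonicity of chords.  The diagonals [p(s), p(t)] and [0, p(w)] of a convex
    quadrilateral meet at the point k p(w); their total length dominates that
    of two opposite sides, one of which is a radius, of length 1 like the
    diagonal [0, p(w)]. *)
Lemma chord_mono s w t : s <= w -> w <= t -> 0 < t - s -> t - s < pi ->
  chord w t <= chord s t /\ chord s w <= chord s t.
Proof.
move=> sw wt st0 stpi.
have [a [b [a0 b0 xE yE _]]] := arc_decomp sw wt st0 stpi.
have h1 : 1 <= a + b.
  rewrite -(nu_pt w) xE yE; apply: le_trans (nuD _ _ _ _) _.
  by rewrite !nu_Zpt !ger0_norm.
have c0 : 0 < a + b by lra.
have cn := lt0r_neq0 c0.
pose k := (a + b)^-1.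
have k0 : 0 < k by rewrite invr_gt0.
have k1 : k <= 1 by rewrite invf_le1.
have kab : k * a + k * b = 1 by rewrite -mulrDr mulVf.
have nk : `|k| = k by rewrite gtr0_norm.
have nka : `|k * a| = k * a by rewrite ger0_norm// mulr_ge0// ltW.
have nkb : `|k * b| = k * b by rewrite ger0_norm// mulr_ge0// ltW.
have nk' : `|k - 1| = 1 - k by rewrite ler0_norm ?opprB// subr_le0.
have T c d x y x' y' :
    nu (c * x + d * x') (c * y + d * y') <= `|c| * nu x y + `|d| * nu x' y'.
  by rewrite -!nuZ; exact: nuD.
have gE : chord s t = k * a * chord s t + k * b * chord s t by rewrite -mulrDl kab mul1r.
split.
- have := T (k * a) (k - 1) (px t - px s) (py t - py s) (px w) (py w).
  rewrite nka nk' nu_pt mulr1 -/(chord s t).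
  have -> : k * a * (px t - px s) + (k - 1) * px w = px t - px w.
    by rewrite xE /k; field.
  have -> : k * a * (py t - py s) + (k - 1) * py w = py t - py w.
    by rewrite yE /k; field.
  rewrite -/(chord w t) => e1.
  have := T (k * b) k (px s - px t) (py s - py t) (px w) (py w).
  rewrite nkb nk nu_pt mulr1 -/(chord t s) (chordC t s).
  have -> : k * b * (px s - px t) + k * px w = px s by rewrite xE /k; field.
  have -> : k * b * (py s - py t) + k * py w = py s by rewrite yE /k; field.
  rewrite nu_pt => e2; lra.
- have := T (k * b) (k - 1) (px s - px t) (py s - py t) (px w) (py w).
  rewrite nkb nk' nu_pt mulr1 -/(chord t s) (chordC t s).
  have -> : k * b * (px s - px t) + (k - 1) * px w = px s - px w.
    by rewrite xE /k; field.
  have -> : k * b * (py s - py t) + (k - 1) * py w = py s - py w.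
    by rewrite yE /k; field.
  rewrite -/(chord w s) (chordC w s) => e1.
  have := T (k * a) k (px t - px s) (py t - py s) (px w) (py w).
  rewrite nka nk nu_pt mulr1 -/(chord s t).
  have -> : k * a * (px t - px s) + k * px w = px t by rewrite xE /k; field.
  have -> : k * a * (py t - py s) + k * py w = py t by rewrite yE /k; field.
  rewrite nu_pt => e2; lra.
Qed.

(** The argument of (x, y), chosen within a quarter turn of [m]; it depends
    continuously on (x, y) in the half-plane around the direction [m]. *)
Definition arg_near (m x y : R) :=
  m + atan ((y * cos m - x * sin m) / (x * cos m + y * sin m)).

Lemma polar m x y : 0 < x * cos m + y * sin m ->
  x = nu x y * px (arg_near m x y) /\ y = nu x y * py (arg_near m x y).
Proof.
move=> p0; have pn := lt0r_neq0 p0.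
set g := arg_near m x y.
set k := (y * cos m - x * sin m) / (x * cos m + y * sin m).
have cb : 0 < cos (atan k) by rewrite cos_gt0_pihalf// atan_gtNpi2 atan_ltpi2.
have cbn := lt0r_neq0 cb.
pose l := (x * cos m + y * sin m) / cos (atan k).
have l0 : 0 < l by rewrite divr_gt0.
have sb : sin (atan k) = k * cos (atan k) by rewrite -{2}(atanK k) /tan divfK.
have cs := cos2Dsin2 m.
have s2 : sin m ^+ 2 = 1 - cos m ^+ 2 by lra.
have xE : x = l * cos g.
  rewrite /g /arg_near -/k cosD sb /l.
  have -> : (x * cos m + y * sin m) / cos (atan k) *
     (cos m * cos (atan k) - sin m * (k * cos (atan k))) =
     (x * cos m + y * sin m) * cos m - sin m * (k * (x * cos m + y * sin m)) by field.
  by rewrite /k divfK//; ring: s2.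
have yE : y = l * sin g.
  rewrite /g /arg_near -/k sinD sb /l.
  have -> : (x * cos m + y * sin m) / cos (atan k) *
     (sin m * cos (atan k) + cos m * (k * cos (atan k))) =
     (x * cos m + y * sin m) * sin m + cos m * (k * (x * cos m + y * sin m)) by field.
  by rewrite /k divfK//; ring: s2.
have nE : nu x y = l * nu (cos g) (sin g) by rewrite {1}xE {1}yE nuZ gtr0_norm.
have nn : nu (cos g) (sin g) != 0 by rewrite lt0r_neq0// nu_cossin_gt0.
by rewrite nE /px /py /radius; split; [rewrite {1}xE|rewrite {1}yE]; field.
Qed.

Lemma arg_near_cvg {T : Type} {F : set_system T} {FF : Filter F}
    (fm fx fy : T -> R) (m x y : R) : 0 < x * cos m + y * sin m ->
  fm @ F --> m -> fx @ F --> x -> fy @ F --> y ->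
  (fun z => arg_near (fm z) (fx z) (fy z)) @ F --> arg_near m x y.
Proof.
move=> p0 cm cx cy.
have ccos : (fun z => cos (fm z)) @ F --> cos m.
  by apply: cvg_comp cm _; exact: continuous_cos.
have csin : (fun z => sin (fm z)) @ F --> sin m.
  by apply: cvg_comp cm _; exact: continuous_sin.
apply: cvgD => //; apply: cvg_comp; last exact: continuous_atan.
apply: cvgM; first by apply: cvgB; apply: cvgM.
apply: cvgV; first exact: lt0r_neq0.
by apply: cvgD; apply: cvgM.
Qed.

(** * Directions of the sum and of the difference of two unit vectors *)

(** By symmetry of the angles, the sum of two unit vectors lies in the half-plane
    around their bisecting direction, and their difference in the half-plane
    around the orthogonal direction. *)
Definition sum_angle s t := arg_near ((s + t) / 2) (px t + px s) (py t + py s).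
Definition diff_angle s t :=
  arg_near ((s + t) / 2 + pi / 2) (px t - px s) (py t - py s).

Lemma sum_proj s t :
  (px t + px s) * cos ((s + t) / 2) + (py t + py s) * sin ((s + t) / 2) =
  (radius s + radius t) * cos ((t - s) / 2).
Proof.
have e1 : cos ((t - s) / 2) = cos (t - (s + t) / 2) by congr cos; field.
have e2 : cos ((t - s) / 2) = cos (s - (s + t) / 2).
  by rewrite -cosN; congr cos; field.
by rewrite [RHS]mulrDl {1}e2 e1 !cosB /px /py; ring.
Qed.

Lemma diff_proj s t :
  (px t - px s) * cos ((s + t) / 2 + pi / 2) +
  (py t - py s) * sin ((s + t) / 2 + pi / 2) =
  (radius s + radius t) * sin ((t - s) / 2).
Proof.
have e1 : sin ((t - s) / 2) = sin (t - (s + t) / 2) by congr sin; field.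
have e2 : sin ((t - s) / 2) = - sin (s - (s + t) / 2).
  by rewrite -sinN; congr sin; field.
by rewrite [RHS]mulrDl {1}e2 e1 !sinB cosDpihalf sinDpihalf /px /py; ring.
Qed.

Lemma sum_proj_gt0 s t : 0 < t - s -> t - s < pi ->
  0 < (px t + px s) * cos ((s + t) / 2) + (py t + py s) * sin ((s + t) / 2).
Proof.
move=> h0 h1; rewrite sum_proj mulr_gt0 ?addr_gt0 ?radius_gt0//.
by apply: cos_gt0_pihalf; apply/andP; split; lra.
Qed.

Lemma diff_proj_gt0 s t : 0 < t - s -> t - s < pi ->
  0 < (px t - px s) * cos ((s + t) / 2 + pi / 2) +
      (py t - py s) * sin ((s + t) / 2 + pi / 2).
Proof.
move=> h0 h1; rewrite diff_proj mulr_gt0 ?addr_gt0 ?radius_gt0//.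
by apply: sin_gt0_pi; apply/andP; split; lra.
Qed.

Lemma sum_polar s t : 0 < t - s -> t - s < pi ->
  px t + px s = sum_norm s t * px (sum_angle s t) /\
  py t + py s = sum_norm s t * py (sum_angle s t).
Proof. by move=> h0 h1; apply: polar; exact: sum_proj_gt0. Qed.

Lemma diff_polar s t : 0 < t - s -> t - s < pi ->
  px t - px s = chord s t * px (diff_angle s t) /\
  py t - py s = chord s t * py (diff_angle s t).
Proof. by move=> h0 h1; apply: polar; exact: diff_proj_gt0. Qed.

Section Cvg.
Context {T : Type} {F : set_system T} {FF : Filter F}.
Variables (fs ft : T -> R) (s t : R).
Hypotheses (cs : fs @ F --> s) (ct : ft @ F --> t).

Let cpxs : px (fs z) @[z --> F] --> px s.
Proof. by apply: cvg_comp cs _; exact: continuous_px. Qed.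
Let cpxt : px (ft z) @[z --> F] --> px t.
Proof. by apply: cvg_comp ct _; exact: continuous_px. Qed.
Let cpys : py (fs z) @[z --> F] --> py s.
Proof. by apply: cvg_comp cs _; exact: continuous_py. Qed.
Let cpyt : py (ft z) @[z --> F] --> py t.
Proof. by apply: cvg_comp ct _; exact: continuous_py. Qed.
Let cm : (fs z + ft z) / 2 @[z --> F] --> (s + t) / 2.
Proof. by apply: cvgMl; apply: cvgD. Qed.

Lemma chord_cvg : chord (fs z) (ft z) @[z --> F] --> chord s t.
Proof. by apply: nu_cvg; apply: cvgB. Qed.

Lemma sum_angle_cvg : 0 < t - s -> t - s < pi ->
  sum_angle (fs z) (ft z) @[z --> F] --> sum_angle s t.
Proof.
move=> h0 h1; apply: arg_near_cvg; first exact: sum_proj_gt0.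
- exact: cm.
- by apply: cvgD.
- by apply: cvgD.
Qed.

Lemma diff_angle_cvg : 0 < t - s -> t - s < pi ->
  diff_angle (fs z) (ft z) @[z --> F] --> diff_angle s t.
Proof.
move=> h0 h1; apply: arg_near_cvg; first exact: diff_proj_gt0.
- by apply: cvgD; [exact: cm|exact: cvg_cst].
- by apply: cvgB.
- by apply: cvgB.
Qed.
End Cvg.

Lemma sum_angleDpi s t : sum_angle (s + pi) (t + pi) = sum_angle s t + pi.
Proof.
rewrite /sum_angle !pxDpi !pyDpi /arg_near.
have -> : (s + pi + (t + pi)) / 2 = (s + t) / 2 + pi by field.
rewrite cosDpi sinDpi [RHS]addrAC; congr (_ + atan _).
by congr (_ / _); ring.
Qed.

Lemma diff_angleDpi s t : diff_angle (s + pi) (t + pi) = diff_angle s t + pi.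
Proof.
rewrite /diff_angle !pxDpi !pyDpi /arg_near.
have -> : (s + pi + (t + pi)) / 2 + pi / 2 = (s + t) / 2 + pi / 2 + pi by field.
rewrite cosDpi sinDpi [RHS]addrAC; congr (_ + atan _).
by congr (_ / _); ring.
Qed.

Lemma chordDpi s t : chord (s + pi) (t + pi) = chord s t.
Proof. by rewrite /chord !pxDpi !pyDpi -!opprD nuN. Qed.

Lemma sum_angle_gt s t : (s + t) / 2 - pi / 2 < sum_angle s t.
Proof. by rewrite /sum_angle /arg_near ltrD2l atan_gtNpi2. Qed.

Lemma diff_angle_gt s t : (s + t) / 2 < diff_angle s t.
Proof. by rewrite /diff_angle /arg_near -addrA ltrDl -ltrBlDl sub0r atan_gtNpi2. Qed.

(** The identity det(r, r') + det(q, q') = 2 (det(u, u') + det(v, v')) for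
    r = v - u and q = v + u is the bilinear expansion.  The signs say that r and
    q turn counterclockwise when u and v do; they follow from the triangle
    inequalities of [arc_triangle] on the arcs from s to t' and from s' to t'. *)
Lemma advance s t s' t' : s <= s' -> s' < t -> t <= t' -> t' - s < pi ->
  let P := area2 (diff_angle s t) (diff_angle s' t') in
  let Q := area2 (sum_angle s t) (sum_angle s' t') in
  [/\ 0 <= chord s t * chord s' t' * P, 0 <= sum_norm s t * sum_norm s' t' * Q &
      chord s t * chord s' t' * P + sum_norm s t * sum_norm s' t' * Q =
      2 * (area2 s s' + area2 t t')].
Proof.
move=> ss' s't tt' t's P Q.
have h1 : 0 < t - s by lra.
have h2 : t - s < pi by lra.
have h3 : 0 < t' - s' by lra.
have h4 : t' - s' < pi by lra.
have [xd yd] := diff_polar h1 h2.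
have [xd' yd'] := diff_polar h3 h4.
have [xs ys] := sum_polar h1 h2.
have [xs' ys'] := sum_polar h3 h4.
have PE : chord s t * chord s' t' * P =
    area2 t t' + area2 s' t - area2 s t' + area2 s s'.
  transitivity ((px t - px s) * (py t' - py s') - (py t - py s) * (px t' - px s')).
    by rewrite xd yd xd' yd' /P /area2; ring.
  by rewrite /area2; ring.
have QE : sum_norm s t * sum_norm s' t' * Q =
    area2 t t' - area2 s' t + area2 s t' + area2 s s'.
  transitivity ((px t + px s) * (py t' + py s') - (py t + py s) * (px t' + px s')).
    by rewrite xs ys xs' ys' /Q /area2; ring.
  by rewrite /area2; ring.
have [] := @arc_triangle s s' t' ss' _ _ t's; [lra|lra|move=> a1 a2 a3].
have [] := @arc_triangle s' t t' _ tt' h3 h4; [lra|move=> b1 b2 b3].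
rewrite PE QE; split; lra.
Qed.

Lemma chord_id s : chord s s = 0.
Proof. by rewrite /chord !subrr; have := nuZ 0 0 0; rewrite !mul0r normr0 mul0r. Qed.

Lemma chord_antipode s : chord s (s + pi) = 2.
Proof.
rewrite /chord pxDpi pyDpi.
have -> : - px s - px s = - 2 * px s by ring.
have -> : - py s - py s = - 2 * py s by ring.
by rewrite nu_Zpt normrN ger0_norm.
Qed.

(** * Minimization along a level set of the chord length *)

(** By monotonicity of chords, moving only t forward does not decrease the chord
    and moving only s forward does not increase it; an intermediate motion
    preserves it. *)
Lemma chord_level_advance s t d : 0 < t - s -> t - s < pi ->
  0 < d -> d < t - s -> d < pi - (t - s) ->
  exists x, [/\ 0 <= x, x <= d & chord (s + x) (t + d - x) = chord s t].
Proof.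
move=> h0 h1 d0 d1 d2.
have cg : {within `[0, d], continuous (fun x => chord (s + x) (t + d - x))}.
  apply: continuous_subspaceT => x; apply: chord_cvg.
    by apply: cvgD; [exact: cvg_cst|exact: cvg_id].
  by apply: cvgB; [exact: cvg_cst|exact: cvg_id].
have [] := @IVT R _ 0 d (chord s t) (ltW d0) cg.
  rewrite addr0 subr0 addrK ge_min le_max.
  have [||||_ ->] := @chord_mono s t (t + d); try lra.
  have [||||-> _] := @chord_mono s (s + d) t; try lra.
by move=> x; rewrite in_itv /= => /andP[x0 xd] <-; exists x; split.
Qed.

(** By invariance of [G] under a half turn it is enough to minimize over the s in
    the compact interval from pi to 2 pi; those s' between s and s + pi that lie
    beyond 2 pi return to it after a half turn. *)
Lemma chord_level_min (eps : R) (G : R -> R -> R) : 0 < eps -> eps < 2 ->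
  (forall s t, pi <= s -> 0 < t - s -> t - s < pi ->
    {for (s, t), continuous (fun z : R * R => G z.1 z.2)}) ->
  (forall s t, pi <= s -> 0 < t - s -> t - s < pi -> G (s + pi) (t + pi) = G s t) ->
  exists s t, [/\ pi <= s, 0 < t - s, t - s < pi, chord s t = eps &
    forall s' t', s <= s' -> s' <= s + pi -> 0 < t' - s' -> t' - s' < pi ->
      chord s' t' = eps -> G s t <= G s' t'].
Proof.
move=> eps0 eps2 Gc Gp.
have pi0 := @pi_gt0 R.
pose g (z : R * R) := chord z.1 (z.1 + z.2).
have gc : continuous g.
  move=> z; apply: chord_cvg; first exact: cvg_fst.
  by apply: cvgD; [exact: cvg_fst|exact: cvg_snd].
(* The coordinates are s and the angle t - s. *)
pose K := g @^-1` [set x | x = eps] `&` (`[pi, pi + pi] `*` `[0, pi]).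
have Kc : compact K.
  apply: (@subclosed_compact _ _ (`[pi, pi + pi] `*` `[0, pi])).
  - apply: closedI; first by move/continuous_closedP: gc; apply; exact: closed_eq.
    have c1 : closed (fst @^-1` `[pi, pi + pi] `&` snd @^-1` `[0, pi] : set (R * R)).
      apply: closedI; apply: preimage_closed; try exact: itv_closed.
        by move=> z _; exact: cvg_fst.
      by move=> z _; exact: cvg_snd.
    exact: c1.
  - by apply: compact_setX; exact: segment_compact.
  - by move=> z [].
have Kin z : K z -> [/\ pi <= z.1, z.1 <= pi + pi, 0 < z.2, z.2 < pi & g z = eps].
  move=> [/= gz]; rewrite !in_itv /= => -[/andP[z1 z1'] /andP[z2 z2']]; split => //.
    rewrite lt_neqAle z2 andbT; apply/eqP => z20; move: gz.
    by rewrite /g -z20 addr0 chord_id => e0; rewrite e0 ltxx in eps0.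
  rewrite lt_neqAle z2' andbT; apply/eqP => z20; move: gz.
  by rewrite /g z20 chord_antipode => e0; rewrite e0 ltxx in eps2.
have K0 : K !=set0.
  have [||x] := @IVT R (fun x => chord pi (pi + x)) 0 pi eps (ltW pi0).
  - apply: continuous_subspaceT => x; apply: chord_cvg; first exact: cvg_cst.
    by apply: cvgD; [exact: cvg_cst|exact: cvg_id].
  - by rewrite addr0 chord_id chord_antipode ge_min le_max (ltW eps0) (ltW eps2) orbT.
  rewrite in_itv /= => xp xe; exists (pi, x).
  by split => //=; rewrite !in_itv/= xp lexx lerDl ltW.
have Gw : {within K, continuous (fun z : R * R => G z.1 (z.1 + z.2))}.
  apply: continuous_in_subspaceT => z /set_mem /Kin[z1 _ z2 z2' _].
  have dz : z.1 + z.2 - z.1 = z.2 by rewrite addrC addKr.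
  have cG : {for (z.1, z.1 + z.2), continuous (fun z : R * R => G z.1 z.2)}.
    by apply: Gc; rewrite ?dz.
  have c1 : (fun z : R * R => z.1) @ z --> z.1 by exact: cvg_fst.
  have c2 : (fun z : R * R => z.1 + z.2) @ z --> z.1 + z.2.
    by apply: cvgD; [exact: cvg_fst|exact: cvg_snd].
  have c3 : (fun z : R * R => (z.1, z.1 + z.2)) @ z --> (z.1, z.1 + z.2).
    exact: cvg_pair c1 c2.
  exact: cvg_comp c3 cG.
have [[s d] /set_mem /Kin/= [s1 s2 d0 dpi sd] smin] := compact_EVT_min K0 Kc Gw.
exists s, (s + d); have dE : s + d - s = d by rewrite addrC addKr.
rewrite dE; split => // s' t' ss' s'2 t0 tpi gE.
have mem s1' t1' : pi <= s1' -> s1' <= pi + pi -> 0 < t1' - s1' -> t1' - s1' < pi ->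
    chord s1' t1' = eps -> G s (s + d) <= G s1' t1'.
  move=> a1 a2 a3 a4 a5.
  have := smin (s1', t1' - s1'); rewrite /= subrKC; apply.
  apply/mem_set; split; first by rewrite /= /g /= subrKC.
  by split; rewrite /= in_itv/= ?a1 ?a2// !ltW.
have [s'pi|s'pi] := leP s' (pi + pi); first by apply: mem => //; lra.
have s'E : s' = s' - pi + pi by rewrite subrK.
have t'E : t' = t' - pi + pi by rewrite subrK.
have tsE : t' - pi - (s' - pi) = t' - s' by ring.
rewrite s'E t'E Gp ?tsE//; last by lra.
apply: mem; rewrite ?tsE//; [lra|lra|].
by rewrite -chordDpi !subrK.
Qed.

(** * Nordlander's theorem *)

Theorem nordlander_plane (eps M : R) : 0 < eps -> eps < 2 -> 0 < M ->
  4 < eps ^+ 2 + M ^+ 2 -> exists s t, chord s t = eps /\ sum_norm s t <= M.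
Proof.
move=> eps0 eps2 M0 eM; apply: contrapT => noex.
have big s t : chord s t = eps -> M < sum_norm s t.
  by move=> gE; rewrite ltNge; apply/negP => sM; apply: noex; exists s, t.
have pi0 := @pi_gt0 R.
have cr2 : continuous (fun x => radius x ^+ 2).
  by move=> x; apply: cvgM; exact: continuous_radius.
have [H dH] := exists_antiderivative cr2.
have [A HA] : exists A : R, forall x, 0 < x -> H (x + pi) = H x + A.
  by apply: (antiderivative_periodic pi0 _ dH) => x; rewrite radiusDpi.
have cH x : 0 < x -> {for x, continuous H}.
  move=> x0; apply: differentiable_continuous; apply/derivable1_diffP.
  by have [] := dH x x0.
pose k := (eps ^+ 2 + M ^+ 2) / 2.
have k2 : 2 < k by rewrite /k; lra.
pose G s t := eps ^+ 2 * H (diff_angle s t) + M ^+ 2 * H (sum_angle s t)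
              - k * (H s + H t).
have da0 s t : pi <= s -> 0 < t - s -> 0 < diff_angle s t.
  by move=> h1 h2; have := diff_angle_gt s t; lra.
have sa0 s t : pi <= s -> 0 < t - s -> 0 < sum_angle s t.
  by move=> h1 h2; have := sum_angle_gt s t; lra.
have [||s [t [spi h0 h1 gE Gmin]]] := @chord_level_min eps G eps0 eps2.
- move=> s t h1 h2 h3.
  have s0 : 0 < s by lra.
  have t0 : 0 < t by lra.
  have cs : (fun z : R * R => z.1) @ (s, t) --> s by exact: cvg_fst.
  have ct : (fun z : R * R => z.2) @ (s, t) --> t by exact: cvg_snd.
  have cHs : (fun z : R * R => H z.1) @ (s, t) --> H s.
    exact: cvg_comp cs (cH s s0).
  have cHt : (fun z : R * R => H z.2) @ (s, t) --> H t.
    exact: cvg_comp ct (cH t t0).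
  have cHd : (fun z : R * R => H (diff_angle z.1 z.2)) @ (s, t) --> H (diff_angle s t).
    exact: cvg_comp (diff_angle_cvg cs ct h2 h3) (cH _ (da0 _ _ h1 h2)).
  have cHm : (fun z : R * R => H (sum_angle z.1 z.2)) @ (s, t) --> H (sum_angle s t).
    exact: cvg_comp (sum_angle_cvg cs ct h2 h3) (cH _ (sa0 _ _ h1 h2)).
  have cc (a : R) : (fun _ : R * R => a) @ (s, t) --> a by exact: cvg_cst.
  exact: cvgB (cvgD (cvgM (cc _) cHd) (cvgM (cc _) cHm)) (cvgM (cc k) (cvgD cHs cHt)).
- move=> s t h1 h2 h3.
  have s0 : 0 < s by lra.
  have t0 : 0 < t by lra.
  rewrite /G diff_angleDpi sum_angleDpi !HA ?da0 ?sa0//.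
  by rewrite /k; field.
(* Chosen so that k (1 - eta) > 2 (1 + eta). *)
pose eta := (k - 2) / (2 * (k + 2)).
have eta0 : 0 < eta by rewrite divr_gt0//; lra.
have etaE : eta * (k + 2) = (k - 2) / 2.
  by rewrite /eta; field; apply/eqP; lra.
have cs : (fun z : R * R => z.1) @ (s, t) --> s by exact: cvg_fst.
have ct : (fun z : R * R => z.2) @ (s, t) --> t by exact: cvg_snd.
have cd := diff_angle_cvg cs ct h0 h1.
have cm := sum_angle_cvg cs ct h0 h1.
pose sector (x y : R) := x <= y ->
    (1 - eta) * area2 x y <= H y - H x /\ H y - H x <= (1 + eta) * area2 x y.
have sectorP (x : R) : 0 < x -> \forall y \near x, sector x y.
  move=> x0.
  have := sector_ratio (radius_gt0 x) (@continuous_radius x) (dH x x0) eta0.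
  by apply: filterS => y hy xy; rewrite area2E; exact: hy.
have close (x : R) : \forall y \near x, `|x - y| < (pi : R).
  by apply/nbhs_ballP; exists pi.
have ns : \forall z \near (s, t), sector s z.1.
  by apply: cs; apply: sectorP; lra.
have nt : \forall z \near (s, t), sector t z.2.
  by apply: ct; apply: sectorP; lra.
have nd : \forall z \near (s, t), sector (diff_angle s t) (diff_angle z.1 z.2).
  by apply: cd; apply: sectorP; exact: da0.
have nm : \forall z \near (s, t), sector (sum_angle s t) (sum_angle z.1 z.2).
  by apply: cm; apply: sectorP; exact: sa0.
have nd' : \forall z \near (s, t), `|diff_angle s t - diff_angle z.1 z.2| < pi.
  exact: cd _ (close _).
have nm' : \forall z \near (s, t), `|sum_angle s t - sum_angle z.1 z.2| < pi.
  exact: cm _ (close _).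
have /nbhs_ballP[e /= e0 near_st] : \forall z \near (s, t),
    (sector s z.1 /\ sector t z.2) /\
    ((sector (diff_angle s t) (diff_angle z.1 z.2) /\
      sector (sum_angle s t) (sum_angle z.1 z.2)) /\
     (`|diff_angle s t - diff_angle z.1 z.2| < pi /\
      `|sum_angle s t - sum_angle z.1 z.2| < pi)).
  exact: filterI (filterI ns nt) (filterI (filterI nd nm) (filterI nd' nm')).
(* A step short enough for the sector estimates and for s < s' < t <= t' < s + pi. *)
pose d := Num.min (e / 2) (Num.min ((t - s) / 2) ((pi - (t - s)) / 2)).
have d0 : 0 < d by rewrite /d !lt_min; apply/and3P; split; lra.
have de : d <= e / 2 by rewrite /d ge_min lexx.
have dts : d <= (t - s) / 2 by rewrite /d !ge_min lexx orbT.
have dpi : d <= (pi - (t - s)) / 2 by rewrite /d !ge_min lexx !orbT.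
have [|||||x [x0 xd gE']] := @chord_level_advance s t d; try lra.
move: gE'; rewrite gE; set s' := s + x; set t' := t + d - x => gE'.
have ss' : s <= s' by rewrite /s'; lra.
have tt' : t <= t' by rewrite /t'; lra.
have s't : s' < t by rewrite /s'; lra.
have t's : t' - s < pi by rewrite /t'; lra.
have [] := near_st (s', t').
  by split => /=; rewrite /ball/= distrC ger0_norm /s' /t'; lra.
move=> [/= /(_ ss')[Hs _] /(_ tt')[Ht _]] [[Nd Nm] [cld clm]].
have [] := advance ss' s't tt' t's.
rewrite gE gE'.
set P := area2 (diff_angle s t) _; set Q := area2 (sum_angle s t) _.
move=> P0 Q0 PQ.
have sp := big _ _ gE; have sp' := big _ _ gE'.
have spsp : M ^+ 2 <= sum_norm s t * sum_norm s' t'.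
  by rewrite expr2 ler_pM// ltW.
have {}P0 : 0 <= P by move: P0; rewrite pmulr_rge0 ?mulr_gt0.
have {}Q0 : 0 <= Q.
  by move: Q0; rewrite pmulr_rge0//; apply: lt_le_trans spsp; rewrite exprn_gt0.
have [_ Hd] := Nd (le_of_area2_ge0 cld P0).
have [_ Hm] := Nm (le_of_area2_ge0 clm Q0).
have min' : G s t <= G s' t' by apply: Gmin => //; lra.
have U0 : 0 < area2 s s' + area2 t t'.
  have [x00|xn0] := eqVneq x 0.
    apply: ltr_wpDl; first by apply: area2_ge0; lra.
    by apply: area2_gt0; rewrite /t' x00; lra.
  have xp : 0 < x by rewrite lt_neqAle eq_sym xn0.
  apply: ltr_pwDl; last by apply: area2_ge0; lra.
  by apply: area2_gt0; rewrite /s'; lra.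
set U := area2 s s' + area2 t t' in PQ U0.
have c1 : k * ((1 - eta) * U) <= k * ((H s' - H s) + (H t' - H t)).
  by apply: ler_wpM2l; [lra|rewrite /U mulrDr lerD].
have c2 : eps ^+ 2 * (H (diff_angle s' t') - H (diff_angle s t)) <=
    eps ^+ 2 * ((1 + eta) * P).
  by apply: ler_wpM2l => //; exact: sqr_ge0.
have c3 : M ^+ 2 * (H (sum_angle s' t') - H (sum_angle s t)) <=
    M ^+ 2 * ((1 + eta) * Q).
  by apply: ler_wpM2l => //; exact: sqr_ge0.
have c4 : M ^+ 2 * ((1 + eta) * Q) <= (1 + eta) * (sum_norm s t * sum_norm s' t' * Q).
  rewrite mulrCA; apply: ler_wpM2l; first by lra.
  by apply: ler_wpM2r.
have c5 : eps ^+ 2 * ((1 + eta) * P) = (1 + eta) * (eps * eps * P) by ring.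
have c6 : (1 + eta) * (eps * eps * P) + (1 + eta) * (sum_norm s t * sum_norm s' t' * Q)
   = (1 + eta) * (2 * U) by rewrite -mulrDr PQ.
have c7 : k * ((1 - eta) * U) <= (1 + eta) * (2 * U).
  move: min'; rewrite /G; lra.
have : (k * (1 - eta) - 2 * (1 + eta)) * U <= 0 by lra.
have -> : k * (1 - eta) - 2 * (1 + eta) = (k - 2) / 2.
  have -> : k * (1 - eta) - 2 * (1 + eta) = k - 2 - eta * (k + 2) by ring.
  by rewrite etaE; field.
by rewrite leNgt mulr_gt0//; lra.
Qed.
End PlaneNorm.

Lemma nordlander (R : realType) (X : normedModType R) (eps M : R) :
  dim_geq 2 X -> 0 < eps -> eps < 2 -> 0 < M -> 4 < eps ^+ 2 + M ^+ 2 ->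
  exists u v : X, [/\ `|u| = 1, `|v| = 1, `|v - u| = eps & `|v + u| <= M].
Proof.
move=> [e efree] eps0 eps2 M0 eM.
pose vec x y : X := x *: e ord0 + y *: e ord_max.
pose nu x y := `|vec x y|.
have vecD x y x' y' : vec (x + x') (y + y') = vec x y + vec x' y'.
  by rewrite /vec !scalerDl addrACA.
have vecN x y : vec (- x) (- y) = - vec x y by rewrite /vec !scaleNr opprD.
have nuD x y x' y' : nu (x + x') (y + y') <= nu x y + nu x' y'.
  by rewrite /nu vecD ler_normD.
have nuZ k x y : nu (k * x) (k * y) = `|k| * nu x y.
  by rewrite /nu /vec -!scalerA -scalerDr normrZ.
have nu_eq0 x y : nu x y = 0 -> x = 0 /\ y = 0.
  move=> /normr0_eq0 v0.
  have h := efree (fun i => if i == ord0 then x else y).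
  have := h; rewrite !big_ord_recl big_ord0 addr0 /= => h'.
  have l1 : lift ord0 ord0 = ord_max :> 'I_2 by apply/val_inj.
  move: h'; rewrite l1 => /(_ v0) h'.
  by split; [have := h' ord0|have := h' ord_max].
have [s [t [gE sM]]] := nordlander_plane nuD nuZ nu_eq0 eps0 eps2 M0 eM.
exists (vec (px nu s) (py nu s)), (vec (px nu t) (py nu t)).
split.
- exact: (nu_pt nuD nuZ nu_eq0 s).
- exact: (nu_pt nuD nuZ nu_eq0 t).
- by rewrite -vecN -vecD.
- by rewrite -vecD.
Qed.

(** * From Nordlander's theorem to the constant *)

(** Along the ray from b through a + b, the convex function norm is at most c at
    the start and at least c at a + b, hence at least c from there on. *)
Lemma ge_norm_scale_add (R : realType) (X : normedModType R) (a b : X) (c k : R) :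
  1 <= k -> `|b| <= c -> c <= `|a + b| -> c <= `|k *: a + b|.
Proof.
move=> k1 bc cab; have k0 : 0 < k by exact: lt_le_trans k1.
have E : k *: (a + b) = (k *: a + b) + (k - 1) *: b.
  by rewrite scalerDr scalerBl scale1r -addrA subrKC.
have h1 : k * `|a + b| <= `|k *: a + b| + (k - 1) * `|b|.
  rewrite -{1}(gtr0_norm k0) -normrZ E -{2}(@ger0_norm _ (k - 1)) ?subr_ge0//.
  by rewrite -normrZ ler_normD.
have h2 : k * c <= k * `|a + b| by rewrite ler_pM2l.
have h3 : (k - 1) * `|b| <= (k - 1) * c by rewrite ler_wpM2l// subr_ge0.
lra.
Qed.

Lemma pair_far_from_origin (R : realType) (X : normedModType R) (kappa tau c : R) :
  dim_geq 2 X -> 0 < kappa -> 0 < tau -> kappa <= c -> tau < c ->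
  c ^+ 2 < kappa ^+ 2 + tau ^+ 2 ->
  exists x y : X, [/\ `|x| = 1, `|y| = 1, c <= `|kappa *: x + tau *: y| &
    c <= `|kappa *: x - tau *: y|].
Proof.
move=> dimX k0 t0 kc tc cc.
have c0 : 0 < c by exact: lt_trans tc.
have cn := lt0r_neq0 c0.
have [||||u [v [u1 v1 uv1 uv2]]] := @nordlander R X (2 * tau / c) (2 * kappa / c) dimX.
- by rewrite divr_gt0 ?mulr_gt0.
- by rewrite ltr_pdivrMr//; lra.
- by rewrite divr_gt0 ?mulr_gt0.
- rewrite !expr_div_n -mulrDl ltr_pdivlMr ?exprn_gt0//.
  rewrite !exprMn; lra.
pose a := (c / 2) *: (v + u); pose b := (c / 2) *: (v - u).
have c20 : 0 <= c / 2 by lra.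
have na : `|a| <= kappa.
  rewrite normrZ ger0_norm//; apply: le_trans (ler_wpM2l c20 uv2) _.
  by rewrite le_eqVlt; apply/orP; left; apply/eqP; field.
have nb : `|b| = tau by rewrite normrZ ger0_norm// uv1; field.
have ab1 : a + b = c *: v.
  rewrite -scalerDr addrACA subrr addr0 -mulr2n -(scaler_nat 2 v) scalerA.
  by congr (_ *: _); field.
have ab2 : a - b = c *: u.
  rewrite -scalerBr opprB (addrC v) addrACA subrr addr0 -mulr2n -(scaler_nat 2 u) scalerA.
  by congr (_ *: _); field.
have nab1 : `|a + b| = c by rewrite ab1 normrZ v1 mulr1 gtr0_norm.
have nab2 : `|a - b| = c by rewrite ab2 normrZ u1 mulr1 gtr0_norm.
(* If a vanished, the norm of b alone would be c > tau. *)
have a0 : 0 < `|a|.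
  rewrite normr_gt0; apply/eqP => a0; move: nab1.
  by rewrite a0 add0r nb => tE; rewrite tE ltxx in tc.
exists (`|a|^-1 *: a), (tau^-1 *: b).
have E1 : kappa *: (`|a|^-1 *: a) = (kappa / `|a|) *: a by rewrite scalerA.
have E2 : tau *: (tau^-1 *: b) = b by rewrite scalerA mulfV ?scale1r ?lt0r_neq0.
have ka : 1 <= kappa / `|a| by rewrite ler_pdivlMr// mul1r.
rewrite E1 E2; split.
- by rewrite normrZ gtr0_norm ?invr_gt0// mulVf// lt0r_neq0.
- by rewrite normrZ nb gtr0_norm ?invr_gt0// mulVf// lt0r_neq0.
- by apply: ge_norm_scale_add; rewrite // ?nb ?nab1 // ltW.
- by apply: ge_norm_scale_add; rewrite // ?normrN ?nb ?nab2 // ltW.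
Qed.

Theorem proposition2 (R : realType) (X : completeNormedModType R)
    (dimX : dim_geq 2 X) (kappa tau : R)
    (kappa_gt0 : 0 < kappa) (tau_gt0 : 0 < tau) :
  Num.sqrt (kappa ^+ 2 + tau ^+ 2) <= T1 kappa tau X
  /\ T1 kappa tau X <= kappa + tau.
Proof.
set c0 := Num.sqrt _.
have c0sq : c0 ^+ 2 = kappa ^+ 2 + tau ^+ 2.
  by rewrite sqr_sqrtr// addr_ge0 ?sqr_ge0.
have kc : kappa < c0.
  rewrite -(ltr_pXn2r (n := 2)) ?nnegrE ?sqrtr_ge0 ?(ltW kappa_gt0)//.
  by rewrite c0sq ltrDl exprn_gt0.
have tc : tau < c0.
  rewrite -(ltr_pXn2r (n := 2)) ?nnegrE ?sqrtr_ge0 ?(ltW tau_gt0)//.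
  by rewrite c0sq ltrDr exprn_gt0.
have approx c : kappa <= c -> tau < c -> c < c0 ->
  exists x y : X, [/\ `|x| = 1, `|y| = 1, c <= `|kappa *: x + tau *: y| &
    c <= `|kappa *: x - tau *: y|].
  move=> c1 c2 c3; apply: pair_far_from_origin => //.
  by rewrite -c0sq ltr_pXn2r// ?nnegrE ?sqrtr_ge0// (le_trans _ c1)// ltW.
have upper (x : X * X) : (@unit_sphere R X `*` @unit_sphere R X) x ->
  Num.sqrt (`|kappa *: x.1 + tau *: x.2| * `|kappa *: x.1 - tau *: x.2|) <=
  kappa + tau.
  move=> [/= x1 x2].
  have kt0 : 0 <= kappa + tau by lra.
  have nk : `|kappa *: x.1| = kappa by rewrite normrZ x1 mulr1 gtr0_norm.
  have nt : `|tau *: x.2| = tau by rewrite normrZ x2 mulr1 gtr0_norm.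
  rewrite -(ger0_norm kt0) -sqrtr_sqr ler_sqrt ?exprn_ge0// expr2.
  apply: ler_pM => //.
    by have := ler_normD (kappa *: x.1) (tau *: x.2); rewrite nk nt.
  by have := ler_normB (kappa *: x.1) (tau *: x.2); rewrite nk nt.
have bdd : has_ubound [set Num.sqrt (`|kappa *: x.1 + tau *: x.2| *
    `|kappa *: x.1 - tau *: x.2|) | x in @unit_sphere R X `*` @unit_sphere R X].
  by exists (kappa + tau) => _ [x xS <-]; exact: upper.
split.
  rewrite leNgt; apply/negP => T1c.
  pose m := Num.max (T1 kappa tau X) (Num.max kappa tau).
  have mc : m < c0 by rewrite /m !gt_max T1c kc tc.
  have [m1 [m2 m3]] : T1 kappa tau X <= m /\ kappa <= m /\ tau <= m.
    by rewrite /m !le_max !lexx !orbT.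
  pose c := (m + c0) / 2.
  have [|||x [y [x1 y1 h1 h2]]] := approx c; try by rewrite /c; lra.
  have cpos : 0 <= c by rewrite /c; lra.
  suff : c <= T1 kappa tau X by rewrite /c; lra.
  apply: le_trans (ub_le_sup bdd _); last by exists (x, y).
  by rewrite /= -{1}(ger0_norm cpos) -sqrtr_sqr ler_wsqrtr// expr2 ler_pM.
apply: ge_sup; last by move=> _ [x xS <-]; exact: upper.
have [|||x [y [x1 y1 _ _]]] := approx ((Num.max kappa tau + c0) / 2).
- have : kappa <= Num.max kappa tau by rewrite le_max lexx.
  lra.
- have : tau <= Num.max kappa tau by rewrite le_max lexx orbT.
  lra.
- have : Num.max kappa tau < c0 by rewrite gt_max kc tc.
  lra.
by eexists; exists (x, y).
Qed.
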